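(* Let $q,m\ge0$ be fixed integers. For all integers $n\ge1$, $d\ge0$, the coefficient $[z^q\zeta^m]\,\mathrm{NN}_{n,d}(z,\zeta,u)$ is a symmetric homogeneous polynomial of degree $m$ in $u_1,\ldots,u_n$. If $$[z^q\zeta^m]\,\mathrm{NN}_{n,d}=\sum_{\lambda\vdash m}F_{q,m,\lambda}(n,d)\,e_\lambda(u),$$ then $F_{q,m,\lambda}(n,d)\in\mathbb{Q}[T_1(n,d),\ldots,T_m(n,d)]$ for every $\lambda\vdash m$, i.e. $F_{q,m,\lambda}(n,d)$ is given by a polynomial with rational coefficients, depending only on $q,m,\lambda$ and not on $n,d$, evaluated at $T_1(n,d),\ldots,T_m(n,d)$. Moreover, $[z^q\zeta^m]\,\mathrm{NN}_{n,d}=0$ if $q>m$.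
   Context: For integers $n\ge1$, $d\ge0$ let $A_{n,d}=\{\alpha\in\mathbb{Z}_{\ge0}^n:\alpha_1+\cdots+\alpha_n=d\}$. With indeterminates $z,\zeta,u=(u_1,\ldots,u_n)$ define $$\mathrm{NN}_{n,d}(z,\zeta,u)=\prod_{\alpha\in A_{n,d}}\Bigl(1+z\bigl(1-\prod_{j=1}^n(1-\zeta u_j)^{\alpha_j}\bigr)\Bigr).$$ (Equivalently, $\mathrm{NN}_{n,d}=(1+z)^{|A_{n,d}|}M_{n,d}(-\tfrac{z}{1+z},X)$ with $X_j=1-\zeta u_j$, where $M_{n,d}(y,X)=\prod_{\alpha\in A_{n,d}}(1+yX_1^{\alpha_1}\cdots X_n^{\alpha_n})$.) $[z^q\zeta^m]$ denotes the coefficient of $z^q\zeta^m$, a polynomial in $u$. Put $T_r(n,d)=\binom{d+n-1}{n+r-1}$, where $\binom ab=0$ for $0\le a<b$. $e_i(u)$ is the $i$-th elementary symmetric polynomial in $u_1,\ldots,u_n$ (zero for $i>n$), and $e_\lambda(u)=\prod_i e_{\lambda_i}(u)$. (When $n<m$ the $e_\lambda(u)$ are not linearly independent; the expansion statement means that the expansion holds with the universal polynomial coefficients.) *)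

(* Defs.v *)
From HB Require Import structures.
From mathcomp Require Import all_boot all_order all_algebra.
From mathcomp Require Import mpoly.

Set Implicit Arguments.
Unset Strict Implicit.
Unset Printing Implicit Defensive.

Import GRing.Theory.

Definition is_partition (m : nat) (s : seq nat) : bool :=
  [&& sorted geq s, 0 \notin s & sumn s == m].

(* Every partition of m has at most m parts, each of them at most m, so the
   bounds in this type, which only make it finite, exclude no partition
   (see intpart_surj). *)
Record intpart (m : nat) : predArgType := IntPart {
  intpart_val : m.-bseq 'I_m.+1;
  _ : is_partition m [seq nat_of_ord i | i <- intpart_val]
}.

HB.instance Definition _ (m : nat) := [isSub for @intpart_val m].
HB.instance Definition _ (m : nat) := [Finite of intpart m by <:].

Definition parts (m : nat) (la : intpart m) : seq nat :=
  [seq nat_of_ord i | i <- intpart_val la].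

Lemma parts_inj (m : nat) : injective (@parts m).
Proof.
by move=> x y /(inj_map val_inj) e; apply/val_inj/val_inj.
Qed.

Lemma partsP (m : nat) (la : intpart m) : is_partition m (parts la).
Proof. exact: (valP la). Qed.

Lemma intpart_surj (m : nat) (s : seq nat) :
  is_partition m s -> exists la : intpart m, parts la = s.
Proof.
move=> sP; have /and3P[_ s0 /eqP sm] := sP.
have le_sz : size s <= m.
  rewrite -sm; elim: s s0 {sP sm} => //= x s IHs.
  by rewrite in_cons eq_sym negb_or -lt0n => /andP[x0 /IHs]; rewrite -add1n; exact: leq_add.
have le_m : all (fun x => x < m.+1) s.
  rewrite -sm; elim: s {sP s0 sm le_sz} => //= x s IHs.
  rewrite ltnS leq_addr /=; apply: sub_all IHs => y /=.
  by rewrite !ltnS => /leq_trans; apply; apply: leq_addl.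
pose t := [seq inord x : 'I_m.+1 | x <- s].
have tE : [seq nat_of_ord i | i <- t] = s.
  rewrite -map_comp -[RHS]map_id; apply/eq_in_map => x /(allP le_m) xm.
  exact: inordK.
have sz_t : size t <= m by rewrite size_map.
have tP : is_partition m [seq nat_of_ord i | i <- Bseq sz_t] by rewrite tE.
by exists (IntPart tP).
Qed.

Local Open Scope ring_scope.

(* The outer polynomial variable is z, the inner one is zeta, and the mpoly
   variables are u_1, ..., u_n; a runs over the exponent vectors in N^n with
   sum of entries d. *)
Definition NN (n d : nat) : {poly {poly {mpoly rat[n]}}} :=
  \prod_(a : 'X_{1..n < d.+1} | mdeg a == d)
     (1 + 'X * (1 - \prod_(j < n) (1 - 'X * ('X_j)%:P) ^+ a j)%:P).

(* The coefficient of z^q zeta^m. *)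
Definition NNcoef (n d q m : nat) : {mpoly rat[n]} := (NN n d)`_q`_m.

Definition Tbin (r n d : nat) : nat := 'C(d + n - 1, n + r - 1).

Definition esympart (n m : nat) (la : intpart m) : {mpoly rat[n]} :=
  \prod_(i <- parts la) mesym n rat i.

(* The i-th variable, i < m, is evaluated at T_(i+1)(n, d). *)
Definition evalT (m n d : nat) (P : {mpoly rat[m]}) : rat :=
  P.@[fun i : 'I_m => (Tbin i.+1 n d)%:R].

(* Main.v *)
(* Put X_j = 1 - zeta u_j and y_a = 1 - X^a, so that [z^q] NN = e_q(y). By
   Newton's identities e_q(y) is a rational polynomial in the power sums
     p_k(y) = sum_i (-1)^i C(k, i) h_d(X_1^i, ..., X_n^i)    (k >= 1).
   With w_j = 1 - X_j^i, the generating function of the h_d gives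
     h_d(1 - w) = sum_r (-1)^r h_r(w) T_r(n, d),
   and w_j is divisible by zeta, so [zeta^m] only involves T_r with r <= m; the
   term r = 0 is the constant T_0, and these cancel in p_k(y) because
   sum_i (-1)^i C(k, i) = 0.  Finally [zeta^m] p_k(w) is a rational multiple of
   p_m(u), so two more applications of Newton's identities express [zeta^m]
   h_r(w) in the e_i(u) with coefficients independent of n and d. *)

Require Import Defs.
From mathcomp Require Import all_boot all_order all_algebra mpoly.
From mathcomp Require Import ring.
Import GRing.Theory.
Local Open Scope ring_scope.

(** * Newton's identities and complete symmetric polynomials *)

Definition psum {R : comNzRingType} (s : seq R) (k : nat) : R := \sum_(x <- s) x ^+ k.

Definition elsym {R : comNzRingType} (s : seq R) (k : nat) : R :=
  (\prod_(x <- s) (1 + 'X * x%:P))`_k.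

(** The complete homogeneous symmetric polynomial h_d of the entries, split by the exponent k of the
    head. *)
Fixpoint hsym {R : comNzRingType} (s : seq R) (d : nat) : R :=
  if s is x :: s' then \sum_(k < d.+1) x ^+ k * hsym s' (d - k) else (d == 0)%:R.

Lemma psum_cons (R : comNzRingType) (x : R) s k : psum (x :: s) k = x ^+ k + psum s k.
Proof. exact: big_cons. Qed.

Lemma elsym_nil (R : comNzRingType) k : elsym (Nil R) k = (k == 0)%:R.
Proof. by rewrite /elsym big_nil coef1. Qed.

Lemma elsym0 (R : comNzRingType) (s : seq R) : elsym s 0 = 1.
Proof.
elim: s => [|x s IHs]; first by rewrite elsym_nil.
by rewrite /elsym big_cons mulrDl mul1r coefD -mulrA coefXM /= addr0.
Qed.

Lemma elsymS (R : comNzRingType) (x : R) s k :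
  elsym (x :: s) k.+1 = elsym s k.+1 + x * elsym s k.
Proof.
by rewrite /elsym big_cons mulrDl mul1r coefD -mulrA coefXM /= coefCM.
Qed.

Lemma hsym0 (R : comNzRingType) (s : seq R) : hsym s 0 = 1.
Proof. by elim: s => //= x s IHs; rewrite big_ord1 mul1r. Qed.

Lemma hsym_cons (R : comNzRingType) (x : R) s d :
  hsym (x :: s) d = \sum_(k < d.+1) x ^+ k * hsym s (d - k).
Proof. by []. Qed.

Arguments hsym : simpl never.

(** Coefficient of t^(d+1) in (1 - x t) H(x :: s) = H(s), where H = sum_d h_d t^d. *)
Lemma hsymS (R : comNzRingType) (x : R) s d :
  hsym (x :: s) d.+1 = hsym s d.+1 + x * hsym (x :: s) d.
Proof.
rewrite !hsym_cons big_ord_recl mul1r subn0 mulr_sumr; congr (_ + _).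
by apply: eq_bigr => i _; rewrite subSS exprS mulrA.
Qed.

Lemma elsym_newton (R : comNzRingType) (s : seq R) k :
  elsym s k.+1 *+ k.+1 =
  \sum_(i < k.+1) (-1) ^+ i * psum s i.+1 * elsym s (k - i).
Proof.
elim: s k => [|x s IHs] k.
  rewrite elsym_nil mul0rn big1 // => i _.
  by rewrite /psum big_nil mulr0 mul0r.
(* With E = sum_k e_k t^k, this is E(s) = E(x :: s) / (1 + x t). It settles the powers of x; the
   terms in p_k(s) are left to the induction hypothesis. *)
have tele j : \sum_(i < j.+1) (-1) ^+ i * x ^+ i.+1 * elsym (x :: s) (j - i) =
              x * elsym s j.
  elim: j => [|j IHj]; first by rewrite big_ord1 !elsym0 mulr1 mul1r mulr1.
  rewrite big_ord_recl subn0 expr1 mul1r.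
  have -> : \sum_(i < j.+1) (-1) ^+ lift ord0 i * x ^+ (lift ord0 i).+1 *
      elsym (x :: s) (j.+1 - lift ord0 i) = - x * (x * elsym s j).
    rewrite -IHj mulr_sumr; apply: eq_bigr => i _.
    rewrite lift0 subSS !exprS; ring.
  rewrite elsymS; ring.
under eq_bigr => i _ do rewrite psum_cons mulrDr mulrDl.
rewrite big_split /= tele big_ord_recr /= subnn elsym0.
under eq_bigr => i _.
  have -> : (k - i = (k - i.+1).+1)%N by rewrite subnSK.
  rewrite elsymS mulrDr; over.
rewrite big_split /= elsymS mulrnDl IHs big_ord_recr /= subnn elsym0.
have -> : \sum_(i < k) (-1) ^+ i * psum s i.+1 * (x * elsym s (k - i.+1))
   = x * (elsym s k *+ k).
  case: k {tele} => [|k]; first by rewrite big_ord0 mulr0n mulr0.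
  rewrite IHs mulr_sumr; apply: eq_bigr => i _; rewrite subSS; ring.
under [in RHS]eq_bigr => i _ do rewrite subnSK //.
rewrite mulrSr -mulrnAr; ring.
Qed.

Lemma hsym_newton (R : comNzRingType) (s : seq R) r :
  hsym s r *+ r = \sum_(k < r) psum s k.+1 * hsym s (r - k.+1).
Proof.
elim: s r => [|x s IHs] r.
  rewrite big1 => [|i _]; last by rewrite /psum big_nil mul0r.
  by case: r => // r; rewrite /hsym mul0rn.
elim: r => [|r IHr]; first by rewrite big_ord0.
under eq_bigr => i _ do rewrite psum_cons mulrDl subSS.
rewrite big_split /= [X in X + _]big_ord_recl subn0 expr1.
have -> : \sum_(i < r) x ^+ (lift ord0 i).+1 * hsym (x :: s) (r - lift ord0 i)
   = x * \sum_(i < r) x ^+ i.+1 * hsym (x :: s) (r - i.+1).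
  by rewrite mulr_sumr; apply: eq_bigr => i _; rewrite lift0 exprS mulrA.
have -> : \sum_(i < r.+1) psum s i.+1 * hsym (x :: s) (r - i) =
  hsym s r.+1 *+ r.+1 + x * \sum_(i < r) psum s i.+1 * hsym (x :: s) (r - i.+1).
  rewrite IHs !big_ord_recr /= !subnn !hsym0 mulr_sumr addrAC -big_split /=.
  congr (_ + _); apply: eq_bigr => i _.
  rewrite subSS -(subnSK (ltn_ord i)) hsymS; ring.
(* The induction hypothesis on r, times x and with p_k(x :: s) = x^k + p_k(s), absorbs both leftover
   sums. *)
have E : x * (hsym (x :: s) r *+ r) =
  x * \sum_(i < r) x ^+ i.+1 * hsym (x :: s) (r - i.+1) +
  x * \sum_(i < r) psum s i.+1 * hsym (x :: s) (r - i.+1).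
  rewrite IHr -mulrDr -big_split /=; congr (_ * _); apply: eq_bigr => i _.
  by rewrite psum_cons mulrDl.
by rewrite addrACA addrAC -addrA [RHS]addrC -addrA -E hsymS mulrnDl (mulrS _ r) mulrnAr; ring.
Qed.

Lemma hsym1 (R : comNzRingType) (x : R) d : hsym [:: x] d = x ^+ d.
Proof.
rewrite hsym_cons big_ord_recr /= subnn mulr1 big1 ?add0r // => k _.
by rewrite -subnSK // mulr0.
Qed.

Lemma hsym_scale (R : comNzRingType) (c : R) s d :
  hsym [seq c * x | x <- s] d = c ^+ d * hsym s d.
Proof.
elim: s d => [|x s IHs] d; first by case: d => [|d]; rewrite /hsym /= ?mulr1 ?mulr0.
rewrite /= !hsym_cons mulr_sumr; apply: eq_bigr => k _; rewrite IHs exprMn.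
by rewrite mulrACA -exprD subnKC // -ltnS.
Qed.

Lemma elsym_scale (R : comNzRingType) (c : R) s k :
  elsym [seq c * x | x <- s] k = c ^+ k * elsym s k.
Proof.
elim: s k => [|x s IHs] [|k]; rewrite ?elsym0 ?mulr1 //.
  by rewrite !elsym_nil mulr0.
by rewrite /= !elsymS !IHs exprS; ring.
Qed.

(* Compare coefficients of t^d in the expansion of prod_j 1 / ((1 - t) + t w_j)
   in powers of t / (1 - t). *)
Lemma hsym_compl (R : comNzRingType) (w : R) s d N : (d < N)%N ->
  hsym [seq 1 - x | x <- w :: s] d =
  \sum_(r < N) (-1) ^+ r * hsym (w :: s) r * 'C(d + size s, size s + r)%:R.
Proof.
elim: s w d N => [|y s IHs] w d N.
  move=> ltdN; rewrite hsym1 exprBn.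
  rewrite (big_ord_widen N (fun i => (-1) ^+ i * 1 ^+ (d - i) * w ^+ i *+ 'C(d, i))) //.
  rewrite big_mkcond; apply: eq_bigr => r _.
  rewrite hsym1 addn0 add0n expr1n mulr1 mulr_natr.
  by case: ltnP => // ltdr; rewrite bin_small.
elim: d N => [|d IHd] [|N] // ltdN.
  rewrite hsym0 big_ord_recl big1 => [|r _].
    by rewrite hsym0 !mul1r !addn0 binn addr0.
  by rewrite bin_small ?mulr0 // add0n lift0 addnS ltnS leq_addr.
rewrite [map _ _]/= hsymS -[_ :: map _ _]/(map (fun x => 1 - x) (y :: s)) (IHs _ _ N.+1) //.
rewrite -[_ :: map _ _]/(map (fun x => 1 - x) (w :: y :: s)).
(* The two copies of h_d take different bounds: [N] in the term - w h_d, which cancels the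
   correction from [hsymS] after the shift r -> r + 1, and [N.+1] in the other, where Pascal's rule
   applies. *)
rewrite mulrBl mul1r {1}(IHd N.+1) ?(ltnW ltdN) // (IHd N) //.
have -> : \sum_(r < N.+1) (-1) ^+ r * hsym (y :: s) r * 'C(d.+1 + size s, size s + r)%:R =
  \sum_(r < N.+1) (-1) ^+ r * hsym (w :: y :: s) r * 'C(d.+1 + size s, size s + r)%:R
  + w * \sum_(r < N) (-1) ^+ r * hsym (w :: y :: s) r * 'C(d + size (y :: s), size (y :: s) + r)%:R.
  rewrite big_ord_recl [in RHS]big_ord_recl !hsym0 -addrA; congr (_ + _).
  rewrite mulr_sumr -big_split /=; apply: eq_bigr => r _.
  rewrite -[bump 0 r]/(r.+1) (hsymS _ w) exprS !addnS !addSn; ring.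
rewrite addrACA subrr addr0 -big_split /=; apply: eq_bigr => r _.
rewrite -mulrDr; congr (_ * _).
by rewrite -natrD /= !addnS !addSn binS addnC.
Qed.

(** For n = [size s] > 0 the truncated subtractions in [Tbin] are exact, and the binomial of
    [hsym_compl], whose tail has n - 1 entries, is T_r(n, d). *)
Lemma hsym_compl_Tbin (R : comNzRingType) (s : seq R) d N :
  (0 < size s)%N -> (d < N)%N ->
  hsym [seq 1 - x | x <- s] d =
  \sum_(r < N) (-1) ^+ r * hsym s r * (Tbin r (size s) d)%:R.
Proof.
case: s => // x s _ ltdN; rewrite (hsym_compl _ _ _ _ _ ltdN).
by apply: eq_bigr => r _; rewrite /Tbin /= addnS addSn !subn1.
Qed.

(** * Sums over exponent vectors, through truncated geometric series *)

Lemma coef_prod_geom (R : comNzRingType) (s : seq R) D d : (d < D)%N ->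
  (\prod_(x <- s) \poly_(k < D) x ^+ k)`_d = hsym s d.
Proof.
elim: s d => [|x s IHs] d ltdD; first by rewrite big_nil coef1.
rewrite big_cons coefM hsym_cons; apply: eq_bigr => k _.
rewrite coef_poly (leq_ltn_trans _ ltdD) ?leq_ord // IHs //.
exact: leq_ltn_trans (leq_subr _ _) ltdD.
Qed.

(** Both sides are the coefficient of t^d in prod_j sum_(k <= d) (Y_j t)^k; distributing the product
    gives a sum over functions from ['I_n] to ['I_d.+1]. *)
Lemma sum_mdeg_hsym (R : comNzRingType) (n d : nat) (Y : 'I_n -> R) :
  \sum_(a : 'X_{1..n < d.+1} | mdeg a == d) \prod_(j < n) Y j ^+ a j =
  hsym [seq Y j | j <- enum 'I_n] d.
Proof.
rewrite -(@coef_prod_geom _ _ d.+1) // big_map big_enum /=.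
have -> : \prod_(j < n) \poly_(k < d.+1) Y j ^+ k =
  \prod_(j < n) \sum_(k < d.+1) Y j ^+ k *: 'X^k.
  by apply: eq_bigr => j _; rewrite poly_def.
rewrite bigA_distr_bigA coef_sum /=.
have cf (f : {ffun 'I_n -> 'I_d.+1}) : (\prod_j (Y j ^+ f j *: 'X^(f j)))`_d =
   if (\sum_j f j)%N == d then \prod_j Y j ^+ f j else 0.
  rewrite scaler_prod coefZ prodrXr coefXn eq_sym.
  by case: ifP; rewrite ?mulr1 ?mulr0.
under [RHS]eq_bigr => f _ do rewrite cf.
rewrite -big_mkcond /=.
(* Mutually inverse in degree d: entries are at most d, so [inord] is faithful, and the default
   [bm0] is never reached. *)
pose toff (a : 'X_{1..n < d.+1}) := [ffun j => inord (a j)] : {ffun 'I_n -> 'I_d.+1}.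
pose tomn (f : {ffun 'I_n -> 'I_d.+1}) : 'X_{1..n < d.+1} :=
  insubd bm0 [multinom (f j : nat) | j < n].
have mdegf (f : {ffun 'I_n -> 'I_d.+1}) : mdeg [multinom (f j : nat) | j < n] = (\sum_j f j)%N.
  by rewrite mdegE; apply: eq_bigr => j _; rewrite mnmE.
have toffE (a : 'X_{1..n < d.+1}) j : toff a j = a j :> nat.
  by rewrite ffunE inordK // (leq_ltn_trans _ (bmdeg a)) // mdegE (bigD1 j) //= leq_addr.
rewrite (reindex_onto toff tomn) /= => [|f /eqP sf]; last first.
  apply/ffunP => j; apply: ord_inj; rewrite toffE /tomn insubdK ?mnmE //.
  by rewrite -topredE /= mdegf sf.
apply: eq_big => [a|a _]; last by apply: eq_bigr => j _; rewrite toffE.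
under eq_bigr => j _ do rewrite toffE.
rewrite -mdegE andb_idr // => _; apply/eqP/val_inj.
rewrite /tomn insubdK; first by apply/mnmP => j; rewrite mnmE toffE.
rewrite -topredE /= mdegf; under eq_bigr => j _ do rewrite toffE.
by rewrite -mdegE bmdeg.
Qed.

Lemma mesymE_elsym (R : comNzRingType) (n k : nat) :
  mesym n R k = elsym [seq 'X_j | j <- enum 'I_n] k.
Proof.
rewrite /elsym big_map big_enum /=.
under eq_bigr => j _ do rewrite addrC.
rewrite bigA_distr coef_sum /mesym [LHS]big_mkcond; apply: eq_bigr => J _.
rewrite -big_mkcond /= big_split /= prodr_const -rmorph_prod /= mulrC coefCM coefXn eq_sym.
by case: ifP; rewrite ?mulr1 ?mulr0.
Qed.

(** * Universal expansions in elementary symmetric polynomials *)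

(* A family f, indexed by (n, d), whose members have a common e-expansion of
   weight m with coefficients in Q[T_1, ..., T_m]. *)
Definition univ (m : nat) (f : forall n d : nat, {mpoly rat[n]}) : Prop :=
  exists P : intpart m -> {mpoly rat[m]}, forall n d : nat, (0 < n)%N ->
    f n d = \sum_(la : intpart m) evalT n d (P la) *: esympart n la.

Lemma eq_univ m f g : (forall n d, (0 < n)%N -> f n d = g n d) -> univ m g -> univ m f.
Proof. by move=> efg [P PE]; exists P => n d n0; rewrite efg // PE. Qed.

Lemma univ0 m : univ m (fun n d => 0).
Proof.
exists (fun=> 0) => n d _; rewrite big1 // => la _.
by rewrite /evalT raddf0 scale0r.
Qed.

Lemma univD m f g : univ m f -> univ m g -> univ m (fun n d => f n d + g n d).
Proof.
move=> [P PE] [Q QE]; exists (fun la => P la + Q la) => n d n0.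
rewrite PE // QE // -big_split /=; apply: eq_bigr => la _.
by rewrite /evalT raddfD scalerDl.
Qed.

Lemma univ_sum m (I : Type) (r : seq I) (p : pred I) (f : I -> forall n d, {mpoly rat[n]}) :
  (forall i, p i -> univ m (f i)) -> univ m (fun n d => \sum_(i <- r | p i) f i n d).
Proof.
move=> fU; elim: r => [|i r IHr].
  by apply: (eq_univ _ _ _ _ (univ0 m)) => n d _; rewrite big_nil.
have [pi|npi] := boolP (p i); last first.
  by apply: (eq_univ _ _ _ _ IHr) => n d _; rewrite big_cons (negPf npi).
apply: (eq_univ _ _ _ _ (univD _ _ _ (fU i pi) IHr)) => n d _.
by rewrite big_cons pi.
Qed.

Lemma univ_evalZ m (p : {mpoly rat[m]}) f :
  univ m f -> univ m (fun n d => evalT n d p *: f n d).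
Proof.
move=> [P PE]; exists (fun la => p * P la) => n d n0.
rewrite PE // scaler_sumr; apply: eq_bigr => la _.
by rewrite scalerA /evalT rmorphM.
Qed.

Lemma univZ m (c : rat) f : univ m f -> univ m (fun n d => c *: f n d).
Proof.
move=> /(univ_evalZ m c%:MP); apply: eq_univ => n d _.
by rewrite /evalT mevalC.
Qed.

(** T_r is the variable of index r - 1. T_0 has no variable, so it must cancel before this
    applies. *)
Lemma univTZ m r f : (0 < r <= m)%N -> univ m f ->
  univ m (fun n d => (Tbin r n d)%:R *: f n d).
Proof.
case: r => // r /= ltrm /(univ_evalZ m 'X_(Ordinal ltrm)); apply: eq_univ => n d _.
by rewrite /evalT mevalXU.
Qed.

(** Sorting [s] gives a partition; the coefficient family is its indicator. *)
Lemma univ_prod_mesym m (s : seq nat) : 0%N \notin s -> sumn s = m ->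
  univ m (fun n d => \prod_(i <- s) mesym n rat i).
Proof.
move=> s0 sm; have sP : is_partition m (sort geq s).
  rewrite /is_partition mem_sort s0 sort_sorted /=; last by move=> x y; apply: leq_total.
  by rewrite (perm_sumn (permEl (perm_sort geq s))) sm.
have [la laE] := intpart_surj sP.
exists (fun mu => (mu == la)%:R) => n d _.
rewrite [RHS](bigD1 la) //= [X in _ + X]big1 => [|mu ne]; last first.
  by rewrite (negPf ne) /evalT raddf0 scale0r.
rewrite eqxx /evalT meval1 scale1r addr0 /esympart laE.
by apply: perm_big; rewrite perm_sym perm_sort.
Qed.

Lemma univ_mesym k : univ k.+1 (fun n d => mesym n rat k.+1).
Proof.
have := univ_prod_mesym k.+1 [:: k.+1] isT (addn0 _).
by apply: eq_univ => n d _; rewrite big_seq1.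
Qed.

Lemma univ1 : univ 0 (fun n d => 1).
Proof.
have := univ_prod_mesym 0 [::] isT (erefl _).
by apply: eq_univ => n d _; rewrite big_nil.
Qed.

Lemma evalT_widen a b (leab : (a <= b)%N) (p : {mpoly rat[a]}) n d :
  evalT n d (p \mPo [tuple 'X_(widen_ord leab i) | i < a]) = evalT n d p.
Proof.
rewrite /evalT comp_mpoly_meval; apply: meval_eq => i.
by rewrite tnth_mktuple mevalXU.
Qed.

(** The product of e_la and e_mu is e of the merged partition, and T_1, ..., T_a and T_1, ..., T_b
    both lie among T_1, ..., T_(a+b). *)
Lemma univM a b f g : univ a f -> univ b g ->
  univ (a + b) (fun n d => f n d * g n d).
Proof.
move=> [P PE] [Q QE].
pose Pw la := P la \mPo [tuple 'X_(widen_ord (leq_addr b a) i) | i < a].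
pose Qw mu := Q mu \mPo [tuple 'X_(widen_ord (leq_addl a b) i) | i < b].
have /eq_univ : forall n d, (0 < n)%N -> f n d * g n d =
   \sum_la \sum_mu evalT n d (Pw la * Qw mu) *:
      \prod_(i <- parts la ++ parts mu) mesym n rat i.
  move=> n d n0; rewrite PE // QE // mulr_suml; apply: eq_bigr => la _.
  rewrite mulr_sumr; apply: eq_bigr => mu _.
  by rewrite /evalT mevalM -!/(evalT _ _ _) !evalT_widen big_cat -scalerAl -scalerAr scalerA.
apply; apply: univ_sum => la _; apply: univ_sum => mu _.
have /and3P[_ la0 /eqP sla] := partsP la.
have /and3P[_ mu0 /eqP smu] := partsP mu.
apply: univ_evalZ; apply: univ_prod_mesym; last by rewrite sumn_cat sla smu.
by rewrite mem_cat negb_or la0.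
Qed.

(** Ties the degree in zeta to the weight in u, so that Cauchy products preserve the property. *)
Definition univp (G : forall n d : nat, {poly {mpoly rat[n]}}) : Prop :=
  forall m, univ m (fun n d => (G n d)`_m).

Lemma eq_univp G H : (forall n d, (0 < n)%N -> G n d = H n d) -> univp H -> univp G.
Proof. by move=> e HU m; apply: eq_univ (HU m) => n d n0; rewrite e. Qed.

Lemma univp_sum (I : Type) (r : seq I) (p : pred I) G :
  (forall i, p i -> univp (G i)) -> univp (fun n d => \sum_(i <- r | p i) G i n d).
Proof.
move=> GU m; apply: eq_univ (univ_sum m I r p (fun i n d => (G i n d)`_m) _) => [n d _|i pi].
  by rewrite coef_sum.
exact: GU.
Qed.

Lemma univpM G H : univp G -> univp H -> univp (fun n d => G n d * H n d).
Proof.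
move=> GU HU m; apply: eq_univ (univ_sum m _ _ xpredT
  (fun (i : 'I_m.+1) n d => (G n d)`_i * (H n d)`_(m - i)) _) => [n d _|i _].
  by rewrite coefM.
by rewrite -{1}(subnKC (leq_ord i)); apply: univM.
Qed.

Lemma univpZ (c : rat) G : univp G -> univp (fun n d => c%:MP%:P * G n d).
Proof.
by move=> GU m; apply: eq_univ (univZ m c _ (GU m)) => n d _; rewrite coefCM mul_mpolyC.
Qed.

Lemma univp1 : univp (fun n d => 1).
Proof.
case=> [|m]; first by apply: eq_univ univ1 => n d _; rewrite coef1.
by apply: eq_univ (univ0 _) => n d _; rewrite coef1.
Qed.

Lemma sign_scaleE n i (p : {mpoly rat[n]}) : (-1) ^+ i *: p = (-1) ^+ i * p.
Proof. by rewrite -mulr_algl -in_algE rmorph_sign. Qed.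

(** Newton's identity solved for p_(m+1), whose coefficient there is the unit (-1)^m. *)
Lemma univ_psum m : univ m.+1 (fun n d => \sum_(j < n) 'X_j ^+ m.+1).
Proof.
elim/ltn_ind: m => m IHm.
pose v n : seq {mpoly rat[n]} := [seq 'X_j | j <- enum 'I_n].
have vp n k : psum (v n) k = \sum_(j < n) 'X_j ^+ k.
  by rewrite /psum big_map big_enum.
pose S n := \sum_(i < m) (-1) ^+ i * psum (v n) i.+1 * mesym n rat (m - i).
have : univ m.+1 (fun n d => (-1) ^+ m *: (m.+1%:R *: mesym n rat m.+1 + (-1) *: S n)).
  apply/univZ/univD; first exact/univZ/univ_mesym.
  apply/univZ/univ_sum => i _.
  have := univM _ _ _ _ (univZ _ ((-1) ^+ i) _ (IHm i (ltn_ord i))) (univ_mesym (m - i.+1)).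
  rewrite subnSK // addSn subnKC; last exact/ltnW.
  apply: eq_univ => n d _.
  by rewrite vp sign_scaleE.
apply: eq_univ => n d _.
rewrite -vp scaleN1r scaler_nat mesymE_elsym elsym_newton big_ord_recr /= subnn elsym0 mulr1.
have -> : S n = \sum_(i < m) (-1) ^+ i * psum (v n) i.+1 * elsym (v n) (m - i).
  by apply: eq_bigr => i _; rewrite mesymE_elsym.
rewrite -/(v n) addrAC subrr add0r sign_scaleE mulrA -exprD.
by rewrite addnn -mul2n exprM sqrrN !expr1n mul1r.
Qed.

(** * The coefficients of NN *)

Lemma natr_mulKC n k (p : {poly {mpoly rat[n]}}) :
  (k.+1%:R^-1)%:MP%:P * (p *+ k.+1) = p.
Proof.
rewrite -[p *+ _]mulr_natl mulrA -(rmorph_nat polyC) -(rmorph_nat (@mpolyC n rat)) -!rmorphM /=.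
have k0 : k.+1%:R != 0 :> rat by rewrite Num.Theory.pnatr_eq0.
by rewrite mulVf // (_ : 1%:MP_[n] = 1) ?mul1r.
Qed.

(** Newton's identity divided by q + 1, possible over the rationals, gives e_(q+1) from power sums
    and earlier e_i. *)
Lemma univp_elsym (Y : forall n d : nat, seq {poly {mpoly rat[n]}}) :
  (forall k, univp (fun n d => psum (Y n d) k.+1)) ->
  forall q, univp (fun n d => elsym (Y n d) q).
Proof.
move=> YU; elim/ltn_ind => -[|q] IHq.
  by apply: eq_univp univp1 => n d _; rewrite elsym0.
apply: eq_univp (univpZ (q.+1%:R^-1) _ (univp_sum _ _ _
  (fun (i : 'I_q.+1) n d => ((-1) ^+ i)%:MP%:P * (psum (Y n d) i.+1 * elsym (Y n d) (q - i))) _))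
  => [n d _|i _].
  rewrite -[LHS](@natr_mulKC n q) elsym_newton; congr (_ * _); apply: eq_bigr => i _.
  by rewrite !rmorph_sign mulrA.
by apply/univpZ/univpM; [apply: YU | apply: IHq; rewrite ltnS leq_subr].
Qed.

Lemma univp_hsym (Y : forall n d : nat, seq {poly {mpoly rat[n]}}) :
  (forall k, univp (fun n d => psum (Y n d) k.+1)) ->
  forall r, univp (fun n d => hsym (Y n d) r).
Proof.
move=> YU; elim/ltn_ind => -[|r] IHr.
  by apply: eq_univp univp1 => n d _; rewrite hsym0.
apply: eq_univp (univpZ (r.+1%:R^-1) _ (univp_sum _ _ _
  (fun (i : 'I_r.+1) n d => psum (Y n d) i.+1 * hsym (Y n d) (r.+1 - i.+1)) _))
  => [n d _|i _].
  by rewrite -[LHS](@natr_mulKC n r) hsym_newton.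
by apply: univpM; [apply: YU | apply: IHr; rewrite subSS ltnS leq_subr].
Qed.

(** Entries without constant term are multiples of zeta, so by homogeneity zeta^k divides e_k and
    h_k. This serves both the vanishing for q > m and the restriction to T_r with r <= m. *)
Lemma map_mulX_drop (R : comNzRingType) (s : seq {poly R}) :
  (forall x, x \in s -> x`_0 = 0) -> s = [seq 'X * x | x <- map (drop_poly 1) s].
Proof.
move=> s0; rewrite -map_comp -[LHS]map_id; apply/eq_in_map => x /s0 x0 /=.
apply/polyP => -[|k]; rewrite coefXM //=.
by rewrite coef_drop_poly addn1.
Qed.

Lemma coef_elsym_small (R : comNzRingType) (s : seq {poly R}) q m :
  (forall x, x \in s -> x`_0 = 0) -> (m < q)%N -> (elsym s q)`_m = 0.
Proof. by move=> /map_mulX_drop -> ltmq; rewrite elsym_scale coefXnM ltmq. Qed.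

Lemma coef_hsym_small (R : comNzRingType) (s : seq {poly R}) r m :
  (forall x, x \in s -> x`_0 = 0) -> (m < r)%N -> (hsym s r)`_m = 0.
Proof. by move=> /map_mulX_drop -> ltmr; rewrite hsym_scale coefXnM ltmr. Qed.

(* p = g(x zeta), where zeta is the variable of p. *)
Definition is_scaled n (x : {mpoly rat[n]}) (g : {poly rat}) (p : {poly {mpoly rat[n]}}) :=
  forall m, p`_m = g`_m *: x ^+ m.

Lemma is_scaled1 n (x : {mpoly rat[n]}) : is_scaled n x 1 1.
Proof. by case=> [|m]; rewrite !coef1 ?scale1r ?scale0r. Qed.

Lemma is_scaledX n (x : {mpoly rat[n]}) : is_scaled n x 'X ('X * x%:P).
Proof.
by move=> [|[|m]]; rewrite coefXM coefX coefC ?scale1r ?scale0r.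
Qed.

Lemma is_scaledB n (x : {mpoly rat[n]}) g h p q :
  is_scaled n x g p -> is_scaled n x h q -> is_scaled n x (g - h) (p - q).
Proof. by move=> gp hq m; rewrite !coefB gp hq scalerBl. Qed.

Lemma is_scaled_exp n (x : {mpoly rat[n]}) g p k :
  is_scaled n x g p -> is_scaled n x (g ^+ k) (p ^+ k).
Proof.
move=> gp; elim: k => [|k IHk]; first exact: is_scaled1.
move=> m; rewrite !exprS !coefM scaler_suml; apply: eq_bigr => i _.
by rewrite gp IHk -scalerAl -scalerAr scalerA -exprD subnKC // -ltnS.
Qed.

Definition onesub (n : nat) (j : 'I_n) : {poly {mpoly rat[n]}} := 1 - 'X * ('X_j)%:P.

Lemma coef0_onesubX n (j : 'I_n) i : (onesub n j ^+ i)`_0 = 1.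
Proof.
elim: i => [|i IHi]; first by rewrite coef1.
by rewrite exprS coefM big_ord1 IHi mulr1 /onesub coefB coef1 coefXM subr0.
Qed.

(** Each summand is one fixed rational polynomial g evaluated at zeta u_j, so the coefficient of
    zeta^m is g_m p_m(u). *)
Lemma univp_psum_onesub i k :
  univp (fun n d => psum [seq 1 - onesub n j ^+ i | j <- enum 'I_n] k.+1).
Proof.
move=> m; pose g : {poly rat} := (1 - (1 - 'X) ^+ i) ^+ k.+1.
have gE n (j : 'I_n) : is_scaled n 'X_j g ((1 - onesub n j ^+ i) ^+ k.+1).
  apply/is_scaled_exp/is_scaledB/is_scaled_exp/is_scaledB/is_scaledX; exact: is_scaled1.
apply: (eq_univ _ _ (fun n d => g`_m *: \sum_(j < n) 'X_j ^+ m)) => [n d _|].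
  rewrite /psum big_map big_enum /= coef_sum scaler_sumr.
  by apply: eq_bigr => j _; apply: gE.
(* For m = 0 the power sum is n, which is not universal; but g_0 = 0. *)
case: m => [|m]; last exact/univZ/univ_psum.
apply: eq_univ (univ0 _) => n d _.
by rewrite -horner_coef0 /g !hornerE /= !(subr0, expr1n, subrr, expr0n) scale0r.
Qed.

Lemma univp_hsym_onesub i : univp (fun n d =>
  hsym [seq onesub n j ^+ i | j <- enum 'I_n] d - (Tbin 0 n d)%:R).
Proof.
move=> m.
pose W n := [seq 1 - onesub n j ^+ i | j <- enum 'I_n].
have WU := univp_hsym (fun n d => W n) (univp_psum_onesub i).
apply: eq_univ (univ_sum m _ (index_enum 'I_m) xpredT
  (fun r n d => (Tbin r.+1 n d)%:R *: ((-1) ^+ r.+1 *: (hsym (W n) r.+1)`_m)) _) => [n d n0|r _];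
  last first.
  apply: univTZ; first exact: ltn_ord.
  by apply: univZ; apply: (WU r.+1 m).
have szW : size (W n) = n by rewrite size_map size_enum_ord.
have W0 x : x \in W n -> x`_0 = 0.
  by case/mapP => j _ ->; rewrite coefB coef1 coef0_onesubX subrr.
have -> : [seq onesub n j ^+ i | j <- enum 'I_n] = [seq 1 - x | x <- W n].
  by rewrite /W -[RHS]map_comp; apply/eq_map => j; rewrite /= opprB addrC subrK.
(* The bound exceeds d, as the expansion requires, and reaches r = m, so that the sum over 1 <= r <=
   m can be widened to it by terms vanishing at zeta^m. *)
have WC : hsym [seq 1 - x | x <- W n] d = \sum_(r < (maxn d m).+1)
   (-1) ^+ r * hsym (W n) r * (Tbin r n d)%:R.
  by rewrite (hsym_compl_Tbin _ _ _ (maxn d m).+1) ?szW // ltnS leq_maxl.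
rewrite WC big_ord_recl hsym0 !mul1r addrC addKr coef_sum.
rewrite (big_ord_widen (maxn d m) (fun r => (Tbin r.+1 n d)%:R *:
  ((-1) ^+ r.+1 *: (hsym (W n) r.+1)`_m))) ?leq_maxr // [RHS]big_mkcond.
apply: eq_bigr => r _; rewrite lift0.
rewrite mulr_natr coefMn -(rmorph_sign polyC) coefCM scaler_nat sign_scaleE.
by have [//|ltmr] := ltnP; rewrite coef_hsym_small // mulr0 mul0rn.
Qed.

(** * The quantities y_a and their power sums *)

Definition NNvars (n d : nat) : seq {poly {mpoly rat[n]}} :=
  [seq 1 - \prod_(j < n) onesub n j ^+ (a : 'X_{1..n}) j |
     a : 'X_{1..n < d.+1} <- enum {: 'X_{1..n < d.+1}} & mdeg a == d].

Lemma NN_elsym n d q m : NNcoef n d q m = (elsym (NNvars n d) q)`_m.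
Proof. by rewrite /NNcoef /NN /elsym big_map big_filter big_enum_cond. Qed.

Lemma coef0_NNvars n d x : x \in NNvars n d -> x`_0 = 0.
Proof.
case/mapP => a _ ->; rewrite coefB coef1 /= -horner_coef0 horner_prod.
by rewrite big1 ?subrr // => j _; rewrite horner_coef0 coef0_onesubX.
Qed.

Lemma univp_psum_NNvars k : univp (fun n d => psum (NNvars n d) k.+1).
Proof.
apply: eq_univp (univp_sum _ (index_enum 'I_k.+2) xpredT (fun i n d =>
  ((-1) ^+ i *+ 'C(k.+1, i))%:MP%:P *
   (hsym [seq onesub n j ^+ i | j <- enum 'I_n] d - (Tbin 0 n d)%:R)) _)
  => [n d n0|i _]; last exact/univpZ/univp_hsym_onesub.
under [RHS]eq_bigr => i _ do rewrite mulrBr.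
rewrite sumrB -mulr_suml -!rmorph_sum /=.
(* The T_0 subtracted for each i costs nothing in total: the alternating sum is (1 - 1)^(k+1), with
   positive exponent. *)
have -> : \sum_(i < k.+2) (-1) ^+ i *+ 'C(k.+1, i) = 0 :> rat.
  transitivity ((1 - 1 : rat) ^+ k.+1); last by rewrite subrr expr0n.
  by rewrite exprBn; apply: eq_bigr => i _; rewrite !expr1n !mulr1.
rewrite mpolyC0 polyC0 mul0r subr0 /psum /NNvars big_map big_filter big_enum_cond /=.
under eq_bigr => a _ do rewrite exprBn.
(* For fixed i, the sum of X^(i a) over the vectors a of degree d is h_d(X_1^i, ..., X_n^i). *)
rewrite exchange_big; apply: eq_bigr => i _ /=.
rewrite -sum_mdeg_hsym mulr_sumr; apply: eq_bigr => a _.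
rewrite expr1n mulr1 -prodrXl !rmorphMn /= !rmorph_sign mulrnAl; congr (_ * _ *+ _).
by apply: eq_bigr => j _; rewrite -!exprM mulnC.
Qed.

Lemma univ_NNcoef q m : univ m (fun n d => NNcoef n d q m).
Proof.
apply: eq_univ (univp_elsym _ univp_psum_NNvars q m) => n d _; exact: NN_elsym.
Qed.

(** * Symmetry, homogeneity and uniqueness of the expansion *)

Lemma esympart_sym n m (la : intpart m) : esympart n la \is symmetric.
Proof. by apply: rpred_prod => i _; apply: mesym_sym. Qed.

Lemma esympart_homog n m (la : intpart m) : esympart n la \is m.-homog.
Proof.
have /and3P[_ _ /eqP sla] := partsP la.
rewrite -{2}sla /esympart; elim: (parts la) => [|i s IHs].
  by rewrite big_nil dhomog1.
by rewrite big_cons dhomogM ?dhomog_mesym.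
Qed.

(** The exponent vector of e_la as a monomial in e_1, ..., e_n: multiplicities of the parts 1, ...,
    n. *)
Definition partmon (n : nat) (s : seq nat) : 'X_{1..n} :=
  [multinom count_mem i.+1 s | i < n].

Lemma mem_partition m s i : is_partition m s -> i \in s -> (0 < i <= m)%N.
Proof.
case/and3P=> _ s0 /eqP <- si; rewrite lt0n (memPn s0) //=.
elim: s si {s0} => //= j s IHs; rewrite inE => /orP[/eqP ->|/IHs le]; first exact: leq_addr.
exact: leq_trans le (leq_addl _ _).
Qed.

Lemma prod_mesym_mPo n (s : seq nat) : (forall i, i \in s -> (0 < i <= n)%N) ->
  \prod_(i <- s) mesym n rat i =
  'X_[partmon n s] \mPo [tuple mesym n rat i.+1 | i < n].
Proof.
elim: s => [|i s IHs] si.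
  have -> : partmon n [::] = 0%MM by apply/mnmP => j; rewrite !mnmE.
  by rewrite big_nil mpolyX0 rmorph1.
rewrite big_cons IHs => [|j js]; last by rewrite si // inE js orbT.
have /andP[i0 lein] := si i (mem_head _ _).
have ltin : (i.-1 < n)%N by rewrite prednK.
have -> : partmon n (i :: s) = (U_(Ordinal ltin) + partmon n s)%MM.
  apply/mnmP => j; rewrite mnmDE !mnmE /=; congr (_ + _)%N.
  by rewrite -val_eqE /= -[in RHS]eqSS prednK.
by rewrite mpolyXD rmorphM /= comp_mpolyXU -tnth_nth tnth_mktuple /= prednK.
Qed.

Lemma esympart_mPo n m (la : intpart m) : (m <= n)%N ->
  esympart n la = 'X_[partmon n (parts la)] \mPo [tuple mesym n rat i.+1 | i < n].
Proof.
move=> lemn; apply: prod_mesym_mPo => i /(mem_partition _ _ _ (partsP la)).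
by case/andP=> -> /leq_trans; apply.
Qed.

Lemma partmon_inj n m : (m <= n)%N -> injective (fun la : intpart m => partmon n (parts la)).
Proof.
move=> lemn la mu /= /mnmP e; apply: parts_inj.
have /and3P[sla _ _] := partsP la; have /and3P[smu _ _] := partsP mu.
apply: (sorted_eq _ _ sla smu).
- by move=> x y z xy yz; apply: leq_trans yz xy.
- by move=> x y; rewrite /= andbC -eqn_leq => /eqP.
(* Sorted lists agree once all multiplicities do; m <= n gives every part a coordinate. *)
apply/allP => i /=; rewrite mem_cat => /orP si.
have /andP[i0 leim] : (0 < i <= m)%N.
  by case: si => si; exact: mem_partition (partsP _) si.
have ltin : (i.-1 < n)%N by rewrite prednK // (leq_trans leim).
by have := e (Ordinal ltin); rewrite !mnmE /= prednK // => ->.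
Qed.

(** Replacing the e_i by variables turns both sums into [mon F] and [mon G], equal by algebraic
    independence of e_1, ..., e_n; their monomials are distinct, so coefficients compare. *)
Lemma esympart_free n m (F G : intpart m -> rat) : (m <= n)%N ->
  \sum_la F la *: esympart n la = \sum_la G la *: esympart n la -> F =1 G.
Proof.
move=> lemn eFG la.
pose mon (H : intpart m -> rat) : {mpoly rat[n]} := \sum_la H la *: 'X_[partmon n (parts la)].
have monE H : \sum_la H la *: esympart n la = mon H \mPo [tuple mesym n rat i.+1 | i < n].
  rewrite raddf_sum; apply: eq_bigr => mu _ /=.
  by rewrite comp_mpolyZ esympart_mPo.
have monK H : (mon H)@_(partmon n (parts la)) = H la.
  rewrite raddf_sum (bigD1 la) //= big1 => [|mu ne]; rewrite mcoeffZ mcoeffX.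
    by rewrite eqxx mulr1 addr0.
  by rewrite (inj_eq (partmon_inj _ _ lemn)) (negPf ne) mulr0.
by rewrite -monK -[RHS]monK (msym_fundamental_un (t1 := mon F) (t2 := mon G)) // -!monE.
Qed.

Theorem theorem2p11 (q m : nat) :
  (forall n d : nat, (0 < n)%N ->
     NNcoef n d q m \is symmetric /\ NNcoef n d q m \is m.-homog) /\
  (exists P : intpart m -> {mpoly rat[m]},
     (forall n d : nat, (0 < n)%N ->
        NNcoef n d q m = \sum_(la : intpart m) evalT n d (P la) *: esympart n la) /\
     (forall n d : nat, (0 < n)%N -> (m <= n)%N ->
      forall F : intpart m -> rat,
        NNcoef n d q m = \sum_(la : intpart m) F la *: esympart n la ->
        forall la : intpart m, F la = evalT n d (P la))) /\
  ((m < q)%N -> forall n d : nat, (0 < n)%N -> NNcoef n d q m = 0).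
Proof.
have [P PE] := univ_NNcoef q m.
split=> [n d n0|].
  rewrite PE //; split; apply: rpred_sum => la _; apply: rpredZ.
    exact: esympart_sym.
  exact: esympart_homog.
(* Every y_a is divisible by zeta, hence e_q(y) by zeta^q. *)
split=> [|ltmq n d _]; last by rewrite NN_elsym coef_elsym_small //; apply: coef0_NNvars.
exists P; split=> // n d n0 lemn F FE.
by apply: (esympart_free n m) => //; rewrite -FE PE.
Qed.
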